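(* If the complex-valued functions $\psi_1$ and $\psi_2$ satisfying the Weierstrass–Enneper system $$\partial\psi_1=p\,\psi_2,\qquad \bar\partial\psi_2=-p\,\psi_1,\qquad \bar\partial\bar\psi_1=p\,\bar\psi_2,\qquad \partial\bar\psi_2=-p\,\bar\psi_1,\qquad p=|\psi_1|^2+|\psi_2|^2,$$ are subjected to the differential constraints $$\psi_1\,\partial\bar\psi_1+\bar\psi_2\,\partial\psi_2=0,\qquad \bar\psi_1\,\bar\partial\psi_1+\psi_2\,\bar\partial\bar\psi_2=0,$$ then the Weierstrass–Enneper system is reduced to the linear decoupled system of second order $$\bar\partial\partial\psi_i+p_0^2\,\psi_i=0,\qquad \partial\bar\partial\bar\psi_i+p_0^2\,\bar\psi_i=0,\qquad i=1,2,$$ where $p_0$ is a constant with $$|\psi_1|^2+|\psi_2|^2=p_0\in\mathbb{R}^+ .$$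
   Context: $\psi_1,\psi_2$ are functions of $z$ and $\bar z$; $\partial=\partial/\partial z$ and $\bar\partial=\partial/\partial\bar z$ are the derivatives with respect to the complex variable $z$ and its conjugate $\bar z$, and a bar over a function denotes complex conjugation. $\mathbb{R}^+$ denotes the positive real numbers.
   Formalization: The functions ψ₁, ψ₂ are taken to be twice continuously differentiable on a connected open domain and not both identically zero; the zero solution satisfies all hypotheses but gives p₀ = 0, which is not in ℝ⁺. *)

(* Defs.v *)
From Stdlib Require Import Reals.
From Coquelicot Require Import Coquelicot.
Open Scope C_scope.

Definition connected (D : C -> Prop) : Prop :=
  forall U V : C -> Prop,
    open U -> open V ->
    (forall z, D z -> U z \/ V z) ->
    (exists z, D z /\ U z) -> (exists z, D z /\ V z) ->
    exists z, D z /\ U z /\ V z.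

Definition open_connected (D : C -> Prop) : Prop := open D /\ connected D.

(* A function of z and conj z is a plain f : C -> C, viewed as a function of
   the real coordinates x = Re z and y = Im z. *)
Definition xslice (f : C -> C) (z : C) : R -> C := fun t => f (t, Im z).
Definition yslice (f : C -> C) (z : C) : R -> C := fun t => f (Re z, t).

(* [Derive] is total, hence meaningful only where the slice is derivable; see
   [dx_unique] and [dy_unique]. *)
Definition dx (f : C -> C) (z : C) : C :=
  (Derive (fun t => Re (xslice f z t)) (Re z),
   Derive (fun t => Im (xslice f z t)) (Re z)).
Definition dy (f : C -> C) (z : C) : C :=
  (Derive (fun t => Re (yslice f z t)) (Im z),
   Derive (fun t => Im (yslice f z t)) (Im z)).

Definition dz (f : C -> C) (z : C) : C := (dx f z - Ci * dy f z) / 2.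
Definition dzbar (f : C -> C) (z : C) : C := (dx f z + Ci * dy f z) / 2.

Definition conjf (f : C -> C) : C -> C := fun z => Cconj (f z).

(* Real differentiability classes, not holomorphy: C is a normed space over R
   here. *)
Definition C1_on (D : C -> Prop) (f : C -> C) : Prop :=
  forall z, D z ->
    ex_derive (K := R_AbsRing) (V := C_R_NormedModule) (xslice f z) (Re z) /\
    ex_derive (K := R_AbsRing) (V := C_R_NormedModule) (yslice f z) (Im z) /\
    continuous (U := C_UniformSpace) (dx f) z /\
    continuous (U := C_UniformSpace) (dy f) z.

Definition C2_on (D : C -> Prop) (f : C -> C) : Prop :=
  C1_on D f /\ C1_on D (dx f) /\ C1_on D (dy f).

Definition density (psi1 psi2 : C -> C) (z : C) : R :=
  (Cmod (psi1 z) ^ 2 + Cmod (psi2 z) ^ 2)%R.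

Definition weierstrass_enneper (D : C -> Prop) (psi1 psi2 : C -> C) : Prop :=
  let p := density psi1 psi2 in
  forall z, D z ->
    dz psi1 z = p z * psi2 z /\
    dzbar psi2 z = - p z * psi1 z /\
    dzbar (conjf psi1) z = p z * conjf psi2 z /\
    dz (conjf psi2) z = - p z * conjf psi1 z.

Definition differential_constraints (D : C -> Prop) (psi1 psi2 : C -> C)
    : Prop :=
  forall z, D z ->
    psi1 z * dz (conjf psi1) z + conjf psi2 z * dz psi2 z = 0 /\
    conjf psi1 z * dzbar psi1 z + psi2 z * dzbar (conjf psi2) z = 0.

Definition linear_second_order (D : C -> Prop) (p0 : R) (psi : C -> C)
    : Prop :=
  forall z, D z ->
    dzbar (dz psi) z + p0 ^ 2 * psi z = 0 /\
    dz (dzbar (conjf psi)) z + p0 ^ 2 * conjf psi z = 0.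

Lemma is_derive_Re_Im (g : R -> C) (t : R) (l : C) :
  is_derive (K := R_AbsRing) (V := C_R_NormedModule) g t l ->
  is_derive (fun s => Re (g s)) t (Re l) /\
  is_derive (fun s => Im (g s)) t (Im l).
Proof.
intros H; split.
- apply (filterdiff_comp g (fun w : C_R_NormedModule => Re w) _
    (fun w : C_R_NormedModule => Re w) H).
  apply filterdiff_linear, (is_linear_fst (U := R_NormedModule) (V := R_NormedModule)).
- apply (filterdiff_comp g (fun w : C_R_NormedModule => Im w) _
    (fun w : C_R_NormedModule => Im w) H).
  apply filterdiff_linear, (is_linear_snd (U := R_NormedModule) (V := R_NormedModule)).
Qed.

Lemma dx_unique (f : C -> C) (z l : C) :
  is_derive (K := R_AbsRing) (V := C_R_NormedModule) (xslice f z) (Re z) l ->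
  dx f z = l.
Proof.
intros H; destruct (is_derive_Re_Im _ _ _ H) as [H1 H2].
transitivity (Re l, Im l); [| now destruct l].
apply injective_projections; apply is_derive_unique; assumption.
Qed.

Lemma dy_unique (f : C -> C) (z l : C) :
  is_derive (K := R_AbsRing) (V := C_R_NormedModule) (yslice f z) (Im z) l ->
  dy f z = l.
Proof.
intros H; destruct (is_derive_Re_Im _ _ _ H) as [H1 H2].
transitivity (Re l, Im l); [| now destruct l].
apply injective_projections; apply is_derive_unique; assumption.
Qed.

(* Main.v *)
(* Adding [conj psi1 * dz psi1 + psi2 * dz (conj psi2) = 0], which the system
   gives, to the first constraint yields [dz p = 0] for the density [p].  As [p]
   is real, both of its partial derivatives vanish, so [p] is constant on the
   connected domain; differentiating the first-order system once more then gives
   the linear equations, using that [dz] and [dzbar] commute on C^2 functions for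
   [psi2]. *)
Require Import Defs.
From Stdlib Require Import Reals Lra.
From Coquelicot Require Import Coquelicot.
Open Scope C_scope.

(** * Functions with vanishing gradient on a connected open set *)

Lemma locally_rectangle (P : C -> Prop) (z : C) :
  locally z P ->
  exists d : posreal, forall u v : R,
    (Rabs (u - Re z) < d)%R -> (Rabs (v - Im z) < d)%R -> P (u, v).
(* Balls of the product uniform structure on [C] are open squares with sides parallel to the
   axes. *)
Proof. intros [d Hd]; exists d; intros u v Hu Hv; apply Hd; split; assumption. Qed.

Lemma locally_xslice (P : C -> Prop) (z : C) :
  locally z P -> locally (Re z) (fun t => P (t, Im z)).
Proof.
intros H; destruct (locally_rectangle _ _ H) as [d Hd].
exists d; intros t Ht; apply Hd; [exact Ht |].
rewrite Rminus_diag, Rabs_R0; apply cond_pos.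
Qed.

Lemma locally_yslice (P : C -> Prop) (z : C) :
  locally z P -> locally (Im z) (fun t => P (Re z, t)).
Proof.
intros H; destruct (locally_rectangle _ _ H) as [d Hd].
exists d; intros t Ht; apply Hd; [| exact Ht].
rewrite Rminus_diag, Rabs_R0; apply cond_pos.
Qed.

Lemma Rabs_between_lt (a x t d : R) :
  (Rmin a x <= t <= Rmax a x)%R -> (Rabs (x - a) < d)%R -> (Rabs (t - a) < d)%R.
Proof.
unfold Rmin, Rmax; intros H1 H2; apply Rabs_def2 in H2; apply Rabs_def1;
  destruct (Rle_dec a x); lra.
Qed.

Lemma derive_zero_eq (h : R -> R) (a x : R) :
  (forall t, (Rmin a x <= t <= Rmax a x)%R -> is_derive h t 0%R) -> h x = h a.
Proof.
intros H; destruct (MVT_gen h a x (fun _ => 0%R)) as [c [_ Hc]].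
- intros t Ht; apply H; lra.
- intros t Ht; apply continuity_pt_filterlim, (ex_derive_continuous h t).
  eexists; apply H; exact Ht.
- lra.
Qed.

(** In a square around [z] inside [D], any point is joined to [z] by a vertical and then a
    horizontal segment, and the mean value theorem makes [g] constant along each. Membership in [D]
    is kept in the conclusion so that level sets within [D] come out open. *)
Lemma zero_gradient_locally_constant (D : C -> Prop) (g : C -> R) (z : C) :
  open D -> D z ->
  (forall w, D w -> is_derive (fun t => g (t, Im w)) (Re w) 0%R /\
                    is_derive (fun t => g (Re w, t)) (Im w) 0%R) ->
  locally z (fun w => D w /\ g w = g z).
Proof.
intros HD Hz Hg; destruct (locally_rectangle D z (HD z Hz)) as [d Hd].
exists d; intros [u v] [Hu Hv]; change (Rabs (u - Re z) < d)%R in Hu;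
  change (Rabs (v - Im z) < d)%R in Hv; split; [now apply Hd |].
transitivity (g (u, Im z)).
- apply (derive_zero_eq (fun t => g (u, t))); intros t Ht.
  apply (Hg (u, t)), Hd; [exact Hu | now apply (Rabs_between_lt _ v)].
- transitivity (g (Re z, Im z)); [| now destruct z].
  apply (derive_zero_eq (fun t => g (t, Im z))); intros t Ht.
  apply (Hg (t, Im z)), Hd; [now apply (Rabs_between_lt _ u) |].
  rewrite Rminus_diag, Rabs_R0; apply cond_pos.
Qed.

(** By local constancy both the level set of [g z] in [D] and its complement in [D] are open. They
    are disjoint and cover [D], so connectedness forbids that both be inhabited. *)
Lemma zero_gradient_constant (D : C -> Prop) (g : C -> R) :
  open_connected D ->
  (forall w, D w -> is_derive (fun t => g (t, Im w)) (Re w) 0%R /\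
                    is_derive (fun t => g (Re w, t)) (Im w) 0%R) ->
  forall z w, D z -> D w -> g w = g z.
Proof.
intros [HD Hconn] Hg z w Hz Hw.
destruct (Req_dec (g w) (g z)) as [E | E]; [exact E | exfalso].
destruct (Hconn (fun x => D x /\ g x = g z) (fun x => D x /\ g x <> g z))
  as [x [_ [[_ H1] [_ H2]]]].
- intros x [Hx <-]; now apply zero_gradient_locally_constant.
- intros x [Hx Hne].
  generalize (zero_gradient_locally_constant D g x HD Hx Hg).
  apply filter_imp; intros y [Hy ->]; now split.
- intros x Hx; destruct (Req_dec (g x) (g z)); [left | right]; now split.
- exists z; now repeat split.
- exists w; now repeat split.
- exact (H2 H1).
Qed.

(** * Real components of the derivatives, and conjugation *)

Lemma C1_on_is_derive (D : C -> Prop) (f : C -> C) (z : C) :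
  C1_on D f -> D z ->
  (is_derive (fun t => Re (f (t, Im z))) (Re z) (Re (dx f z)) /\
   is_derive (fun t => Im (f (t, Im z))) (Re z) (Im (dx f z))) /\
  (is_derive (fun t => Re (f (Re z, t))) (Im z) (Re (dy f z)) /\
   is_derive (fun t => Im (f (Re z, t))) (Im z) (Im (dy f z))).
Proof.
intros Hf Hz; destruct (Hf z Hz) as [[l Hl] [[m Hm] _]].
(* Derivability of the slices ensures that the total [Derive] inside [dx] and [dy] gives the true
   partial derivatives. *)
rewrite (dx_unique _ _ _ Hl), (dy_unique _ _ _ Hm).
split; now apply is_derive_Re_Im.
Qed.

Lemma is_derive_sum_squares (a b c d : R -> R) (t a' b' c' d' : R) :
  is_derive a t a' -> is_derive b t b' -> is_derive c t c' -> is_derive d t d' ->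
  is_derive (fun s => a s ^ 2 + b s ^ 2 + (c s ^ 2 + d s ^ 2))%R t
    (2 * (a t * a' + b t * b' + (c t * c' + d t * d')))%R.
Proof.
intros Ha Hb Hc Hd.
auto_derive; [repeat split; eexists; eassumption |].
repeat match goal with
| |- context [Derive (fun x => ?f x) t] => change (Derive (fun x => f x) t) with (Derive f t)
end.
rewrite (is_derive_unique _ _ _ Ha), (is_derive_unique _ _ _ Hb),
  (is_derive_unique _ _ _ Hc), (is_derive_unique _ _ _ Hd); ring.
Qed.

Lemma Cmod_sqr (z : C) : (Cmod z ^ 2 = Re z ^ 2 + Im z ^ 2)%R.
Proof.
unfold Cmod; apply pow2_sqrt.
apply Rplus_le_le_0_compat; apply pow2_ge_0.
Qed.

Lemma density_Re_Im (psi1 psi2 : C -> C) (z : C) :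
  density psi1 psi2 z =
  (Re (psi1 z) ^ 2 + Im (psi1 z) ^ 2 + (Re (psi2 z) ^ 2 + Im (psi2 z) ^ 2))%R.
Proof. unfold density; now rewrite !Cmod_sqr. Qed.

(** Holds without differentiability, since the total [Derive] always commutes with negation. *)
Lemma dx_conjf (f : C -> C) (z : C) : dx (conjf f) z = Cconj (dx f z).
Proof. apply injective_projections; [reflexivity | apply Derive_opp]. Qed.

Lemma dy_conjf (f : C -> C) (z : C) : dy (conjf f) z = Cconj (dy f z).
Proof. apply injective_projections; [reflexivity | apply Derive_opp]. Qed.

Lemma Re_dz (f : C -> C) (z : C) : Re (dz f z) = ((Re (dx f z) + Im (dy f z)) / 2)%R.
Proof. unfold dz; simpl; field. Qed.

Lemma Im_dz (f : C -> C) (z : C) : Im (dz f z) = ((Im (dx f z) - Re (dy f z)) / 2)%R.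
Proof. unfold dz; simpl; field. Qed.

Lemma Re_dzbar (f : C -> C) (z : C) : Re (dzbar f z) = ((Re (dx f z) - Im (dy f z)) / 2)%R.
Proof. unfold dzbar; simpl; field. Qed.

Lemma Im_dzbar (f : C -> C) (z : C) : Im (dzbar f z) = ((Im (dx f z) + Re (dy f z)) / 2)%R.
Proof. unfold dzbar; simpl; field. Qed.

Lemma dz_conjf (f : C -> C) (z : C) : dz (conjf f) z = Cconj (dzbar f z).
Proof.
unfold dz, dzbar; rewrite dx_conjf, dy_conjf.
apply injective_projections; simpl; field.
Qed.

Lemma dzbar_conjf (f : C -> C) (z : C) : dzbar (conjf f) z = Cconj (dz f z).
Proof.
unfold dz, dzbar; rewrite dx_conjf, dy_conjf.
apply injective_projections; simpl; field.
Qed.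

(** * Locality and real homogeneity of the derivatives *)

Section LocalExtensionality.

Variables (f g : C -> C) (z : C).
Hypothesis Hfg : locally z (fun w => f w = g w).

(** A derivative depends only on the germ at [z]. This allows an equation valid only on the open set
    [D] to be differentiated there. *)
Lemma dx_ext_loc : dx f z = dx g z.
Proof.
apply injective_projections; apply Derive_ext_loc;
  generalize (locally_xslice _ _ Hfg); apply filter_imp; intros t Ht;
  [exact (f_equal Re Ht) | exact (f_equal Im Ht)].
Qed.

Lemma dy_ext_loc : dy f z = dy g z.
Proof.
apply injective_projections; apply Derive_ext_loc;
  generalize (locally_yslice _ _ Hfg); apply filter_imp; intros t Ht;
  [exact (f_equal Re Ht) | exact (f_equal Im Ht)].
Qed.

Lemma dz_ext_loc : dz f z = dz g z.
Proof. unfold dz; now rewrite dx_ext_loc, dy_ext_loc. Qed.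

Lemma dzbar_ext_loc : dzbar f z = dzbar g z.
Proof. unfold dzbar; now rewrite dx_ext_loc, dy_ext_loc. Qed.

End LocalExtensionality.

Lemma Cscal_pair (c : R) (w : C) : c * w = ((c * Re w)%R, (c * Im w)%R).
Proof. apply injective_projections; simpl; unfold Re, Im; ring. Qed.

(** A real scalar acts on the two components separately, and [Derive] is homogeneous even where it
    is a default value. *)
Lemma dx_scal (c : R) (f : C -> C) (z : C) :
  dx (fun w => c * f w) z = c * dx f z.
Proof.
rewrite Cscal_pair.
apply injective_projections; (etransitivity; [| apply Derive_scal]); apply Derive_ext;
  intros t; unfold xslice; now rewrite Cscal_pair.
Qed.

Lemma dy_scal (c : R) (f : C -> C) (z : C) :
  dy (fun w => c * f w) z = c * dy f z.
Proof.
rewrite Cscal_pair.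
apply injective_projections; (etransitivity; [| apply Derive_scal]); apply Derive_ext;
  intros t; unfold yslice; now rewrite Cscal_pair.
Qed.

Lemma dz_scal (c : R) (f : C -> C) (z : C) :
  dz (fun w => c * f w) z = c * dz f z.
Proof. unfold dz; rewrite dx_scal, dy_scal; unfold Cdiv; ring. Qed.

Lemma dzbar_scal (c : R) (f : C -> C) (z : C) :
  dzbar (fun w => c * f w) z = c * dzbar f z.
Proof. unfold dzbar; rewrite dx_scal, dy_scal; unfold Cdiv; ring. Qed.

(** * Commutation of mixed partial derivatives and of [dz] with [dzbar] *)

Lemma continuous_Re_Im (f : C -> C) (z : C) :
  continuous (U := C_UniformSpace) f z ->
  continuity_2d_pt (fun u v => Re (f (u, v))) (Re z) (Im z) /\
  continuity_2d_pt (fun u v => Im (f (u, v))) (Re z) (Im z).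
Proof.
intros Hf; destruct z as [x y]; split; intros eps; apply locally_2d_locally;
  generalize (proj1 (filterlim_locally _ _) Hf eps); apply filter_imp;
  intros [u v] H; apply H.
Qed.

(** Schwarz's theorem for the real and imaginary parts. The C^2 hypothesis makes both mixed partials
    continuous at [z], and openness of [D] makes them exist near [z]. *)
Lemma dx_dy_comm (D : C -> Prop) (f : C -> C) (z : C) :
  open D -> C2_on D f -> D z -> dx (dy f) z = dy (dx f) z.
Proof.
intros HD [Hf [Hfx Hfy]] Hz.
destruct (Hfx z Hz) as [_ [_ [_ Hyx]]]; destruct (Hfy z Hz) as [_ [_ [Hxy _]]].
apply continuous_Re_Im in Hyx, Hxy.
apply injective_projections.
- refine (Schwarz (fun x y => Re (f (x, y))) (Re z) (Im z) _ (proj1 Hxy) (proj1 Hyx)).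
  destruct (locally_rectangle D z (HD z Hz)) as [d Hd].
  exists d; intros u v Hu Hv; assert (Hw := Hd u v Hu Hv).
  destruct (C1_on_is_derive _ _ _ Hf Hw) as [[? _] [? _]].
  destruct (C1_on_is_derive _ _ _ Hfx Hw) as [_ [? _]].
  destruct (C1_on_is_derive _ _ _ Hfy Hw) as [[? _] _].
  repeat split; eexists; eassumption.
- refine (Schwarz (fun x y => Im (f (x, y))) (Re z) (Im z) _ (proj2 Hxy) (proj2 Hyx)).
  destruct (locally_rectangle D z (HD z Hz)) as [d Hd].
  exists d; intros u v Hu Hv; assert (Hw := Hd u v Hu Hv).
  destruct (C1_on_is_derive _ _ _ Hf Hw) as [[_ ?] [_ ?]].
  destruct (C1_on_is_derive _ _ _ Hfx Hw) as [_ [_ ?]].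
  destruct (C1_on_is_derive _ _ _ Hfy Hw) as [[_ ?] _].
  repeat split; eexists; eassumption.
Qed.

Lemma is_derive_half_plus (f g : R -> R) (t f' g' : R) :
  is_derive f t f' -> is_derive g t g' ->
  is_derive (fun s => (f s + g s) / 2)%R t ((f' + g') / 2)%R.
Proof.
intros Hf Hg; apply (is_derive_ext (fun s => scal (/ 2)%R (plus (f s) (g s)))).
- intros s; unfold scal, plus; simpl; unfold mult; simpl; field.
- replace ((f' + g') / 2)%R with (scal (/ 2)%R (plus f' g'))
    by (unfold scal, plus; simpl; unfold mult; simpl; field).
  now apply is_derive_scal, @is_derive_plus.
Qed.

Lemma is_derive_half_minus (f g : R -> R) (t f' g' : R) :
  is_derive f t f' -> is_derive g t g' ->
  is_derive (fun s => (f s - g s) / 2)%R t ((f' - g') / 2)%R.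
Proof.
intros Hf Hg; apply (is_derive_half_plus f (fun s => - g s)%R t f' (- g')%R Hf).
now apply @is_derive_opp.
Qed.

(** Once the mixed partials agree, both sides are a quarter of the Laplacian of [f]. *)
Lemma dz_dzbar_comm (D : C -> Prop) (f : C -> C) (z : C) :
  open D -> C2_on D f -> D z -> dzbar (dz f) z = dz (dzbar f) z.
Proof.
intros HD Hf Hz; pose proof (dx_dy_comm D f z HD Hf Hz) as E.
destruct Hf as [_ [Hfx Hfy]].
destruct (C1_on_is_derive _ _ _ Hfx Hz) as [[A1 A2] [A3 A4]].
destruct (C1_on_is_derive _ _ _ Hfy Hz) as [[B1 B2] [B3 B4]].
(* [Derive] is additive only on derivable functions, so these four expansions rely on the
   derivability of the slices of [dx f] and [dy f]. *)
assert (X1 : dx (dz f) z =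
  ((Re (dx (dx f) z) + Im (dx (dy f) z)) / 2, (Im (dx (dx f) z) - Re (dx (dy f) z)) / 2)%R).
{ apply injective_projections; apply is_derive_unique.
  - apply (is_derive_ext (fun t => (Re (dx f (t, Im z)) + Im (dy f (t, Im z))) / 2)%R).
    + intros t; symmetry; apply Re_dz.
    + now apply is_derive_half_plus.
  - apply (is_derive_ext (fun t => (Im (dx f (t, Im z)) - Re (dy f (t, Im z))) / 2)%R).
    + intros t; symmetry; apply Im_dz.
    + now apply is_derive_half_minus. }
assert (X2 : dy (dz f) z =
  ((Re (dy (dx f) z) + Im (dy (dy f) z)) / 2, (Im (dy (dx f) z) - Re (dy (dy f) z)) / 2)%R).
{ apply injective_projections; apply is_derive_unique.
  - apply (is_derive_ext (fun t => (Re (dx f (Re z, t)) + Im (dy f (Re z, t))) / 2)%R).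
    + intros t; symmetry; apply Re_dz.
    + now apply is_derive_half_plus.
  - apply (is_derive_ext (fun t => (Im (dx f (Re z, t)) - Re (dy f (Re z, t))) / 2)%R).
    + intros t; symmetry; apply Im_dz.
    + now apply is_derive_half_minus. }
assert (X3 : dx (dzbar f) z =
  ((Re (dx (dx f) z) - Im (dx (dy f) z)) / 2, (Im (dx (dx f) z) + Re (dx (dy f) z)) / 2)%R).
{ apply injective_projections; apply is_derive_unique.
  - apply (is_derive_ext (fun t => (Re (dx f (t, Im z)) - Im (dy f (t, Im z))) / 2)%R).
    + intros t; symmetry; apply Re_dzbar.
    + now apply is_derive_half_minus.
  - apply (is_derive_ext (fun t => (Im (dx f (t, Im z)) + Re (dy f (t, Im z))) / 2)%R).
    + intros t; symmetry; apply Im_dzbar.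
    + now apply is_derive_half_plus. }
assert (X4 : dy (dzbar f) z =
  ((Re (dy (dx f) z) - Im (dy (dy f) z)) / 2, (Im (dy (dx f) z) + Re (dy (dy f) z)) / 2)%R).
{ apply injective_projections; apply is_derive_unique.
  - apply (is_derive_ext (fun t => (Re (dx f (Re z, t)) - Im (dy f (Re z, t))) / 2)%R).
    + intros t; symmetry; apply Re_dzbar.
    + now apply is_derive_half_minus.
  - apply (is_derive_ext (fun t => (Im (dx f (Re z, t)) + Re (dy f (Re z, t))) / 2)%R).
    + intros t; symmetry; apply Im_dzbar.
    + now apply is_derive_half_plus. }
apply injective_projections.
- change (Re (dzbar (dz f) z) = Re (dz (dzbar f) z)).
  rewrite Re_dzbar, Re_dz, X1, X2, X3, X4, E; simpl; field.
- change (Im (dzbar (dz f) z) = Im (dz (dzbar f) z)).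
  rewrite Im_dzbar, Im_dz, X1, X2, X3, X4, E; simpl; field.
Qed.

(** * Constancy of the density and the reduction to the linear system *)

(* The conjugate half of the linear system is redundant. *)
Lemma linear_second_order_intro (D : C -> Prop) (p0 : R) (f : C -> C) :
  (forall z, D z -> dzbar (dz f) z = - (p0 ^ 2 * f z)) ->
  linear_second_order D p0 f.
Proof.
intros H z Hz; specialize (H z Hz); split; [rewrite H; ring |].
(* Two conjugations turn the second equation into the conjugate of the first, [p0] being real. *)
rewrite (dz_ext_loc _ (conjf (dz f)))
  by (apply filter_forall; intros w; apply dzbar_conjf).
rewrite dz_conjf, H; unfold conjf.
apply injective_projections; simpl; ring.
Qed.

Lemma density_zero_gradient (D : C -> Prop) (psi1 psi2 : C -> C) :
  C1_on D psi1 -> C1_on D psi2 ->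
  weierstrass_enneper D psi1 psi2 -> differential_constraints D psi1 psi2 ->
  forall z, D z ->
    is_derive (fun t => density psi1 psi2 (t, Im z)) (Re z) 0%R /\
    is_derive (fun t => density psi1 psi2 (Re z, t)) (Im z) 0%R.
Proof.
intros H1 H2 HWE HDC z Hz.
destruct (C1_on_is_derive _ _ _ H1 Hz) as [[A1 A2] [A3 A4]].
destruct (C1_on_is_derive _ _ _ H2 Hz) as [[B1 B2] [B3 B4]].
destruct (HWE z Hz) as [E1 [_ [_ E4]]]; destruct (HDC z Hz) as [E5 _].
(* The left side is the product-rule expansion of [dz p], where [p] is
   [psi1 * conj psi1 + psi2 * conj psi2]. Outside the constraint, the terms [p * conj psi1 * psi2]
   cancel by the system. *)
assert (E : Cconj (psi1 z) * dz psi1 z + psi1 z * dz (conjf psi1) z +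
            (Cconj (psi2 z) * dz psi2 z + psi2 z * dz (conjf psi2) z) = 0).
{ transitivity (Cconj (psi1 z) * dz psi1 z + psi2 z * dz (conjf psi2) z +
    (psi1 z * dz (conjf psi1) z + conjf psi2 z * dz psi2 z));
    [unfold conjf; ring |].
  rewrite E5, E1, E4; unfold conjf; ring. }
assert (dz_pair : forall f, dz f z =
  ((Re (dx f z) + Im (dy f z)) / 2, (Im (dx f z) - Re (dy f z)) / 2)%R)
  by (intros f; rewrite <- Re_dz, <- Im_dz; apply surjective_pairing).
rewrite !dz_pair, !dx_conjf, !dy_conjf in E.
(* The real and imaginary parts of [dz p] are half the x-derivative and minus half the y-derivative
   of the real function [p]. *)
assert (ER := f_equal Re E); assert (EI := f_equal Im E).
split; apply (is_derive_ext _ _ _ _ (fun t => eq_sym (density_Re_Im psi1 psi2 _)));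
  (evar_last; [apply is_derive_sum_squares; eassumption |]);
  cbv beta; change (Re z, Im z) with (fst z, snd z); rewrite <- surjective_pairing;
  revert ER EI;
  generalize (psi1 z) (psi2 z) (dx psi1 z) (dy psi1 z) (dx psi2 z) (dy psi2 z);
  intros [] [] [] [] [] []; simpl; intros; lra.
Qed.

Theorem proposition6 (D : C -> Prop) (psi1 psi2 : C -> C)
  (HD : open_connected D)
  (Hpsi1 : C2_on D psi1) (Hpsi2 : C2_on D psi2)
  (Hnontrivial : exists z, D z /\ (psi1 z <> 0 \/ psi2 z <> 0))
  (HWE : weierstrass_enneper D psi1 psi2)
  (HDC : differential_constraints D psi1 psi2) :
  exists p0 : R,
    (0 < p0)%R /\
    (forall z, D z -> (Cmod (psi1 z) ^ 2 + Cmod (psi2 z) ^ 2)%R = p0) /\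
    linear_second_order D p0 psi1 /\
    linear_second_order D p0 psi2.
Proof.
destruct Hnontrivial as [z0 [Hz0 Hne]].
(* Any point of [D] would give the same constant; at [z0] one of the functions is nonzero, which
   yields positivity. *)
exists (density psi1 psi2 z0); set (p0 := density psi1 psi2 z0).
assert (Hp : forall z, D z -> density psi1 psi2 z = p0).
{ intros z Hz; apply (zero_gradient_constant D); try assumption.
  apply density_zero_gradient; try assumption; [apply Hpsi1 | apply Hpsi2]. }
split; [| split; [exact Hp | split]].
- unfold p0, density.
  assert (Q1 := pow2_ge_0 (Cmod (psi1 z0))); assert (Q2 := pow2_ge_0 (Cmod (psi2 z0))).
  destruct Hne as [Hne | Hne]; apply Cmod_gt_0 in Hne; apply (pow_lt _ 2) in Hne; lra.
- apply linear_second_order_intro; intros z Hz.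
  (* Near [z] the coefficient [p] is the constant [p0], so differentiation passes through it to
     [psi2]. *)
  rewrite (dzbar_ext_loc _ (fun w => p0 * psi2 w)).
  + destruct (HWE z Hz) as [_ [E _]].
    rewrite dzbar_scal, E, (Hp z Hz); ring.
  + generalize (proj1 HD z Hz); apply filter_imp; intros w Hw.
    destruct (HWE w Hw) as [E _]; now rewrite E, (Hp w Hw).
- apply linear_second_order_intro; intros z Hz.
  (* The system prescribes [dzbar psi2] but not [dz psi2], so the order of differentiation is
     exchanged first. *)
  rewrite (dz_dzbar_comm D) by (assumption || apply HD).
  rewrite (dz_ext_loc _ (fun w => (- p0)%R * psi1 w)).
  + destruct (HWE z Hz) as [E _].
    rewrite dz_scal, E, (Hp z Hz), RtoC_opp; ring.
  + generalize (proj1 HD z Hz); apply filter_imp; intros w Hw.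
    destruct (HWE w Hw) as [_ [E _]]; now rewrite E, (Hp w Hw), RtoC_opp.
Qed.
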